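(* Let $m$ be a positive integer, $r$ a nonnegative integer, $\lambda\in\mathbb{R}$. For $n,k\in\mathbb{N}$ with $n\ge k$, $$V_{m,\lambda}^{(r)}(n+1,k)=V_{m,\lambda}^{(r)}(n,k-1)+(k\lambda-r-mn)V_{m,\lambda}^{(r)}(n,k).$$
   Context: $(x)_{0,\lambda}=1$, $(x)_{n,\lambda}=x(x-\lambda)\cdots(x-(n-1)\lambda)$, $(x)_n=(x)_{n,1}$. The degenerate $r$-Whitney numbers of the first kind are defined by the polynomial identities $m^n(x)_n=\sum_{k=0}^n V_{m,\lambda}^{(r)}(n,k)(mx+r)_{k,\lambda}$, $n\ge0$, with the convention $V_{m,\lambda}^{(r)}(n,k)=0$ if $k<0$ or $k>n$. *)

(* Defs.v *)
From HB Require Import structures.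
From mathcomp Require Import all_boot all_order all_algebra reals.

Set Implicit Arguments.
Unset Strict Implicit.
Unset Printing Implicit Defensive.

Import Order.TTheory GRing.Theory Num.Theory.
Local Open Scope ring_scope.

Definition dffact (A : comNzRingType) (x lam : A) (n : nat) : A :=
  \prod_(i < n) (x - i%:R * lam).

(* V n k is V_{m,lam}^{(r)}(n,k). The second index is an integer, so that the
   convention V(n,k) = 0 covers k < 0. The defining identities are equalities
   in {poly R}, 'X being the indeterminate x. *)
Definition degenerate_rWhitney1 (R : realType) (m r : nat) (lam : R)
    (V : nat -> int -> R) : Prop :=
  (forall n : nat,
     m%:R ^+ n *: dffact 'X 1 n =
     \sum_(k < n.+1) V n k%:Z *: dffact (m%:R *: 'X + r%:R) lam%:P k)
  /\ (forall (n : nat) (k : int), k < 0 \/ n%:Z < k -> V n k = 0).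

Lemma graded_family_span (F : fieldType) (q : nat -> {poly F}) :
  (forall k, size (q k) = k.+1) ->
  forall n (p : {poly F}), (size p <= n)%N ->
  exists c : nat -> F, p = \sum_(k < n) c k *: q k.
Proof.
move=> sq; elim=> [|n IHn] p.
  by rewrite leqn0 size_poly_eq0 => /eqP ->; exists (fun=> 0); rewrite big_ord0.
move=> sp; have qn0 : (q n)`_n != 0.
  have : lead_coef (q n) != 0 by rewrite lead_coef_eq0 -size_poly_eq0 sq.
  by rewrite lead_coefE sq.
pose a := p`_n / (q n)`_n.
have [|c Ec] := IHn (p - a *: q n).
  apply/leq_sizeP => j; rewrite leq_eqVlt => /predU1P[<-|ltnj].
    by rewrite coefB coefZ divfK // subrr.
  by rewrite coefB coefZ !nth_default ?mulr0 ?subrr ?sq // (leq_trans sp).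
exists (fun k => if k == n then a else c k).
rewrite big_ord_recr /= eqxx -[LHS](subrK (a *: q n)) Ec; congr (_ + _).
by apply: eq_bigr => k _; rewrite ltn_eqF.
Qed.

Lemma size_dffact (R : idomainType) (p : {poly R}) (c : R) (n : nat) :
  size p = 2 -> size (dffact p c%:P n) = n.+1.
Proof.
move=> sp; rewrite /dffact.
have sz (i : nat) : size (p - i%:R * c%:P) = 2.
  rewrite -polyC_natr -polyCM -polyCN size_polyDl ?sp //.
  by rewrite size_polyC; case: eqP.
elim: n => [|n IHn]; first by rewrite big_ord0 size_poly1.
rewrite big_ord_recr /= size_mul -?size_poly_eq0 ?IHn ?sz //.
by rewrite addn2.
Qed.

Lemma degenerate_rWhitney1_exists (R : realType) (m r : nat) (lam : R) :
  (0 < m)%N -> exists V, degenerate_rWhitney1 m r lam V.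
Proof.
move=> m0; have mR : m%:R != 0 :> R by rewrite pnatr_eq0 -lt0n.
pose q k : {poly R} := dffact (m%:R *: 'X + r%:R) lam%:P k.
have sq k : size (q k) = k.+1.
  apply: size_dffact; rewrite -polyC_natr size_polyDl size_scale ?size_polyX //.
  by rewrite size_polyC; case: eqP.
have sp n : (size (m%:R ^+ n *: dffact ('X : {poly R}) 1 n) <= n.+1)%N.
  by rewrite (leq_trans (size_scale_leq _ _)) // size_dffact ?size_polyX.
pose P n (c : seq R) := m%:R ^+ n *: dffact ('X : {poly R}) 1 n ==
  \sum_(k < n.+1) c`_k *: q k.
have exP n : exists c, P n c.
  have [c Ec] := graded_family_span sq (sp n).
  exists (mkseq c n.+1); apply/eqP; rewrite Ec.
  by apply: eq_bigr => k _; rewrite nth_mkseq.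
exists (fun n k => if (0 <= k) && (k <= n%:Z) then (xchoose (exP n))`_`|k|%N else 0).
split=> [n|n k].
  rewrite (eqP (xchooseP (exP n))); apply: eq_bigr => k _ /=.
  by rewrite lez_nat -ltnS ltn_ord.
by rewrite !ltNge => -[/negPf->|/negPf->]; rewrite ?andbF.
Qed.

(* Main.v *)
Require Import Defs.
From mathcomp Require Import all_boot all_order all_algebra reals ring.
Import Order.TTheory GRing.Theory Num.Theory.
Local Open Scope ring_scope.

(** Write [q k] for the polynomial (mx + r)_{k,lam}. Since m^(n+1) (x)_(n+1) is
    m^n (x)_n times mx - mn, and
    mx - mn = (mx + r - k lam) + (k lam - r - mn),
    multiplying the term V(n,k) [q k] by mx - mn gives
    V(n,k) [q (k+1)] + (k lam - r - mn) V(n,k) [q k]. As [q k] has degree k,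
    the [q k] are linearly independent and coefficients can be compared. *)

(** Only the top term of the sum reaches its degree, and its leading coefficient is nonzero. So the
    top scalar vanishes, and induction on the length handles the rest. *)
Lemma graded_family_free (F : fieldType) (q : nat -> {poly F}) :
  (forall k, size (q k) = k.+1) ->
  forall n (c : nat -> F), \sum_(k < n) c k *: q k = 0 ->
  forall k, (k < n)%N -> c k = 0.
Proof.
move=> sq; elim=> [//|n IHn] c; rewrite big_ord_recr /= => E.
have qn0 : (q n)`_n != 0.
  have : lead_coef (q n) != 0 by rewrite lead_coef_eq0 -size_poly_eq0 sq.
  by rewrite lead_coefE sq.
have cn0 : c n = 0.
  have := congr1 (fun p : {poly F} => p`_n) E.
  rewrite coefD coef_sum big1 => [|i _]; last first.
    by rewrite coefZ nth_default ?mulr0 // sq.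
  by rewrite add0r coefZ coef0 => /eqP; rewrite mulf_eq0 (negPf qn0) orbF => /eqP.
move: E; rewrite cn0 scale0r addr0 => /IHn c0 k.
by rewrite ltnS leq_eqVlt => /predU1P[->//|/c0].
Qed.

Lemma graded_family_coef_inj (F : fieldType) (q : nat -> {poly F}) :
  (forall k, size (q k) = k.+1) ->
  forall n (c d : nat -> F),
  \sum_(k < n) c k *: q k = \sum_(k < n) d k *: q k ->
  forall k, (k < n)%N -> c k = d k.
Proof.
move=> sq n c d E k ltkn; apply/eqP; rewrite -subr_eq0; apply/eqP.
apply: (@graded_family_free F q sq n (fun k => c k - d k)) => //.
under eq_bigr do rewrite scalerBl.
by rewrite sumrB E subrr.
Qed.

Lemma dffactS (A : comNzRingType) (x lam : A) (n : nat) :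
  dffact x lam n.+1 = dffact x lam n * (x - n%:R * lam).
Proof. by rewrite /dffact big_ord_recr. Qed.

Theorem theorem6 (R : realType) (m r : nat) (lam : R) (V : nat -> int -> R)
  (hm : (0 < m)%N) (hV : degenerate_rWhitney1 m r lam V)
  (n k : nat) (hkn : (k <= n)%N) :
  V n.+1 k%:Z = V n (k%:Z - 1) +
    (k%:R * lam - r%:R - m%:R * n%:R) * V n k%:Z.
Proof.
case: hV => hV V0.
have mR : m%:R != 0 :> R by rewrite pnatr_eq0 -lt0n.
pose q k : {poly R} := dffact (m%:R *: 'X + r%:R) lam%:P k.
have sq j : size (q j) = j.+1.
  apply: size_dffact; rewrite -polyC_natr size_polyDl size_scale ?size_polyX //.
  by rewrite size_polyC; case: eqP.
(* Both sides of the recurrence are read as coefficient families on all indices up to [n.+1], the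
   degree of (x)_(n+1). *)
apply: (@graded_family_coef_inj R q sq n.+2 (fun j => V n.+1 j%:Z)
  (fun j => V n (j%:Z - 1) + (j%:R * lam - r%:R - m%:R * n%:R) * V n j%:Z));
  last by rewrite ltnS leqW.
rewrite -hV dffactS exprSr.
have -> : (m%:R ^+ n * m%:R) *: (dffact 'X 1 n * ('X - n%:R * 1)) =
    (m%:R ^+ n *: dffact 'X 1 n) * (m%:R *: 'X - (m%:R * n%:R)%:P) :> {poly R}.
  by rewrite -!mul_polyC !(polyCM, polyC_natr); ring.
rewrite hV mulr_suml.
under [RHS]eq_bigr do rewrite scalerDl.
(* The index shift leaves a boundary term at index 0, which carries [V n (-1) = 0]. *)
rewrite big_split /= [X in _ = X + _]big_ord_recl /= (V0 n (0 - 1)) ?scale0r ?add0r;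
  last by left.
(* The unshifted sum loses its last term because [V n n.+1 = 0]; all sums now run over [j <= n]. *)
rewrite [X in _ = _ + X]big_ord_recr /= (V0 n n.+1) ?mulr0 ?scale0r ?addr0;
  last by right; rewrite ltz_nat.
rewrite -big_split; apply: eq_bigr => j _ /=.
have -> : (bump 0 j)%:Z - 1 = j%:Z by rewrite /bump add1n -addn1 PoszD addrK.
rewrite /q /bump add1n dffactS -!mul_polyC.
by rewrite !(polyCM, polyCB, polyC_natr); ring.
Qed.
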